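(* There is an infinite computably discrete computably Quasi-Polish space $\mathbf{X}$ such that every computable $f:\mathbf{X}\to\mathbb{N}$ is constant.
   Context: A represented space $\mathbf{X}=(X,\delta_{\mathbf{X}})$ is a set $X$ with a partial surjection $\delta_{\mathbf{X}}:\subseteq\mathbb{N}^{\mathbb{N}}\to X$; any $p$ with $\delta_{\mathbf X}(p)=x$ is a name of $x$. A realiser of a map $f:\mathbf{X}\to\mathbf{Y}$ is a partial map $R_f:\subseteq\mathbb{N}^{\mathbb{N}}\to\mathbb{N}^{\mathbb{N}}$ sending every name of every $x\in X$ to a name of $f(x)$; $f$ is computable (continuously realisable) if it has a computable (continuous) realiser. A computable isomorphism is a computable bijection with computable inverse. $\mathbb{N}$ is represented by $\delta_{\mathbb N}(p)=p(0)$. $\mathbf{Y}^{\mathbf{X}}$ is the represented space of total continuously realisable functions; a name of $f$ is a $p\in\mathbb N^{\mathbb N}$ coding a realiser of $f$, with $p(0)$ the index of a Turing machine using the oracle $n\mapsto p(n+1)$. In the product $\mathbf{X}\times\mathbf{Y}$, $p$ names $(x,y)$ iff $n\mapsto p(2n)$ names $x$ and $n\mapsto p(2n+1)$ names $y$. Sierpinski space $\mathbb{S}=\{\top,\bot\}$ is represented so that $0^\omega$ names $\bot$ and every other sequence names $\top$. The space $\mathcal{O}(\mathbf{X})$ of open sets is $\mathbb{S}^{\mathbf{X}}$, identifying $U$ with its characteristic function ($x\mapsto\top$ iff $x\in U$); $U$ is computably open if it is a computable point of $\mathcal O(\mathbf X)$ (i.e. has a computable name). $\mathbf{X}$ is computably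 discrete if the diagonal of $\mathbf X\times\mathbf X$ is computably open, i.e. equality is semidecidable. $\mathbf{X}$ is computably overt if non-emptiness of a given $U\in\mathcal{O}(\mathbf{X})$ is semidecidable, i.e. $\{U\in\mathcal O(\mathbf X)\mid U\neq\emptyset\}$ is computably open in $\mathcal{O}(\mathbf{X})$. For a transitive relation $\ll$ on $\mathbb{N}$, an ideal is a non-empty $I\subseteq\mathbb{N}$ such that $x\ll y\in I$ implies $x\in I$, and for all $x,y\in I$ there is $z\in I$ with $x\ll z$ and $y\ll z$. $\mathbf{I}(\ll)$ is the represented space of ideals, where $p$ names $I$ iff $I=\{p(k)\mid k\in\mathbb{N}\}$. A represented space is precomputably Quasi-Polish if it is computably isomorphic to $\mathbf{I}(\ll)$ for some computably enumerable transitive relation $\ll$ on $\mathbb N$; it is computably Quasi-Polish if it is moreover computably overt. *)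

(* Defs.v *)
From mathcomp Require Import all_boot.
From mathcomp Require Import boolp classical_sets cardinality.
From mathcomp Require Import zify.
From Stdlib Require Import Cantor.

Set Implicit Arguments.
Unset Strict Implicit.
Unset Printing Implicit Defensive.

Local Open Scope classical_set_scope.

Definition baire := nat -> nat.

(* Computability on Baire space. The machine model is Kleene's: partial
   recursive functions relative to an oracle, in the unary form where tuples
   are coded by the Cantor pairing. It has the same computable functions and,
   up to computable translation of indices, the same numbering as oracle
   Turing machines. *)

Definition cpair (a b : nat) : nat := Cantor.to_nat (a, b).
Definition cfst (n : nat) : nat := (Cantor.of_nat n).1.
Definition csnd (n : nat) : nat := (Cantor.of_nat n).2.

Inductive code : Type :=
| Zero
| Succ
| Fst
| Snd
| Oracle
| Pair of code & code
| Comp of code & code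
| Prec of code & code
| Mu of code.

(* [eval p c n v]: the machine [c] with oracle [p] halts on input [n] with
   output [v]. *)
Fixpoint eval (p : baire) (c : code) : nat -> nat -> Prop :=
  match c with
  | Zero => fun _ v => v = 0
  | Succ => fun n v => v = n.+1
  | Fst => fun n v => v = cfst n
  | Snd => fun n v => v = csnd n
  | Oracle => fun n v => v = p n
  | Pair c1 c2 => fun n v =>
      exists v1 v2, [/\ eval p c1 n v1, eval p c2 n v2 & v = cpair v1 v2]
  | Comp c1 c2 => fun n v => exists2 m, eval p c2 n m & eval p c1 m v
  | Prec c1 c2 => fun n v =>
      (fix rec (k : nat) : nat -> Prop :=
         match k with
         | 0 => eval p c1 (cfst n)
         | k'.+1 => fun w =>
             exists2 r, rec k' r & eval p c2 (cpair (cfst n) (cpair k' r)) w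
         end) (csnd n) v
  | Mu c1 => fun n v =>
      eval p c1 (cpair n v) 0 /\
      forall j, j < v -> exists u, eval p c1 (cpair n j) u.+1
  end.

Fixpoint index (c : code) : nat :=
  match c with
  | Zero => 0
  | Succ => 1
  | Fst => 2
  | Snd => 3
  | Oracle => 4
  | Pair c1 c2 => 5 + 4 * cpair (index c1) (index c2)
  | Comp c1 c2 => 6 + 4 * cpair (index c1) (index c2)
  | Prec c1 c2 => 7 + 4 * cpair (index c1) (index c2)
  | Mu c1 => 8 + 4 * index c1
  end.

Definition machine_fun (c : code) (p q : baire) : Prop :=
  forall n, eval p c n (q n).

Definition computable_seq (p : baire) : Prop :=
  exists c, machine_fun c (fun=> 0) p.

(* Partial maps on Baire space are given by their graphs; both predicates below
   force the graph to be single-valued. *)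
Definition computable_pmap (F : baire -> baire -> Prop) : Prop :=
  exists c, forall p q, F p q -> machine_fun c p q.

Definition continuous_pmap (F : baire -> baire -> Prop) : Prop :=
  forall p q, F p q -> forall n, exists k, forall p' q', F p' q' ->
    (forall i, i < k -> p' i = p i) -> q' n = q n.

Definition ce_rel (R : nat -> nat -> Prop) : Prop :=
  exists c, forall x y, R x y <-> exists v, eval (fun=> 0) c (cpair x y) v.

Definition evens (p : baire) : baire := fun n => p n.*2.
Definition odds (p : baire) : baire := fun n => p n.*2.+1.
Definition tail (p : baire) : baire := fun n => p n.+1.
Definition join (p q : baire) : baire :=
  fun n => if odd n then q n./2 else p n./2.

Lemma evens_join p q : evens (join p q) = p.
Proof. by apply: funext => n; rewrite /evens /join odd_double doubleK. Qed.

Lemma odds_join p q : odds (join p q) = q.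
Proof. by apply: funext => n; rewrite /odds /join /= odd_double uphalf_double. Qed.

Lemma cfst_pair a b : cfst (cpair a b) = a.
Proof. by rewrite /cfst /cpair Cantor.cancel_of_to. Qed.

Lemma csnd_pair a b : csnd (cpair a b) = b.
Proof. by rewrite /csnd /cpair Cantor.cancel_of_to. Qed.

Lemma cpair_inj a b a' b' : cpair a b = cpair a' b' -> a = a' /\ b = b'.
Proof.
move=> e; split.
- by rewrite -[LHS](cfst_pair a b) e cfst_pair.
- by rewrite -[LHS](csnd_pair a b) e csnd_pair.
Qed.

Lemma index_inj : injective index.
Proof.
elim=> [|||||c1 IH1 c2 IH2|c1 IH1 c2 IH2|c1 IH1 c2 IH2|c1 IH1]
  [|||||d1 d2|d1 d2|d1 d2|d1] //= e; try (exfalso; lia).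
- have /cpair_inj[/IH1-> /IH2->//] :
    cpair (index c1) (index c2) = cpair (index d1) (index d2) by lia.
- have /cpair_inj[/IH1-> /IH2->//] :
    cpair (index c1) (index c2) = cpair (index d1) (index d2) by lia.
- have /cpair_inj[/IH1-> /IH2->//] :
    cpair (index c1) (index c2) = cpair (index d1) (index d2) by lia.
- by have /IH1-> : index c1 = index d1 by lia.
Qed.

Lemma eval_fun p c n v w : eval p c n v -> eval p c n w -> v = w.
Proof.
elim: c n v w => [|||||c1 IH1 c2 IH2|c1 IH1 c2 IH2|c1 IH1 c2 IH2|c1 IH1]
  n v w /=; try by move=> -> ->.
- by move=> [a [b [a1 b1 ->]]] [a' [b' [/(IH1 _ _ _ a1)<- /(IH2 _ _ _ b1)<- ->]]].
- by move=> [a a2 a1] [b /(IH2 _ _ _ a2)<-]; apply: IH1.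
- elim: (csnd n) v w => [|k IHk] v w; first exact: IH1.
  by move=> [r r1 r2] [s /(IHk _ _ r1)<-]; apply: IH2.
- move=> [v0 vlt] [w0 wlt]; case: (ltngtP v w) => // lt.
  + by have [u /(IH1 _ _ _ v0)] := wlt _ lt.
  + by have [u /(IH1 _ _ _ w0)] := vlt _ lt.
Qed.

Lemma machine_fun_inj c p q q' :
  machine_fun c p q -> machine_fun c p q' -> q = q'.
Proof. by move=> h h'; apply: funext => n; apply: eval_fun (h n) (h' n). Qed.

Record repSpace : Type := RepSpace {
  point :> Type;
  names : baire -> point -> Prop;
  names_inj : forall p x y, names p x -> names p y -> x = y;
  names_surj : forall x, exists p, names p x
}.

Definition realises (X Y : repSpace) (F : baire -> baire -> Prop) (f : X -> Y) :=
  forall p x, names p x -> exists2 q, F p q & names q (f x).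

Definition computable_map (X Y : repSpace) (f : X -> Y) : Prop :=
  exists2 F, computable_pmap F & realises F f.

Definition continuously_realisable (X Y : repSpace) (f : X -> Y) : Prop :=
  exists2 F, continuous_pmap F & realises F f.

Definition computable_point (X : repSpace) (x : X) : Prop :=
  exists2 p, computable_seq p & names p x.

Definition computably_isomorphic (X Y : repSpace) : Prop :=
  exists f : X -> Y, exists g : Y -> X,
    [/\ computable_map f, computable_map g, cancel f g & cancel g f].

Section Nat.

Definition nat_names (p : baire) (n : nat) : Prop := p 0 = n.

Lemma nat_names_inj p m n : nat_names p m -> nat_names p n -> m = n.
Proof. by rewrite /nat_names => ->. Qed.

Lemma nat_names_surj n : exists p, nat_names p n.
Proof. by exists (fun=> n). Qed.

Definition natSpace : repSpace := RepSpace nat_names_inj nat_names_surj.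

End Nat.

Section Sierpinski.

(* [true] is the open point. *)
Definition sierp_names (p : baire) (b : bool) : Prop :=
  b <-> exists n, p n <> 0.

Lemma sierp_names_inj p a b : sierp_names p a -> sierp_names p b -> a = b.
Proof. by move=> ha hb; apply/idP/idP => [/ha/hb|/hb/ha]. Qed.

Lemma sierp_names_surj b : exists p, sierp_names p b.
Proof.
exists (fun=> nat_of_bool b); split=> [->|[_]]; first by exists 0.
by case: b.
Qed.

Definition sierpSpace : repSpace := RepSpace sierp_names_inj sierp_names_surj.

End Sierpinski.

Section Product.
Variables X Y : repSpace.

Definition prod_names (p : baire) (z : X * Y) : Prop :=
  names (evens p) z.1 /\ names (odds p) z.2.

Lemma prod_names_inj p z z' : prod_names p z -> prod_names p z' -> z = z'.
Proof.
case: z z' => [x y] [x' y'] [/= hx hy] [/= hx' hy'].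
by rewrite (names_inj hx hx') (names_inj hy hy').
Qed.

Lemma prod_names_surj z : exists p, prod_names p z.
Proof.
have [p hp] := names_surj z.1; have [q hq] := names_surj z.2.
by exists (join p q); rewrite /prod_names evens_join odds_join.
Qed.

Definition prodSpace : repSpace := RepSpace prod_names_inj prod_names_surj.

End Product.

(* A continuous partial map on Baire space is computable relative to an oracle;
   this is what makes the representation of the function space surjective. *)
Section Associate.

Let cid := Pair Fst Snd.
Let cadd := Prec cid (Comp Succ (Comp Snd Snd)).
Let cdbl := Comp cadd (Pair cid cid).
Let cleft := Comp Oracle cdbl.
Let cright := Comp Oracle (Comp Succ cdbl).
Let chistory := Prec Zero (Pair (Comp Snd Snd) (Comp cright (Comp Fst Snd))).
Let cassoc :=
  Comp Snd (Mu (Comp cleft (Pair cid (Comp chistory (Pair Zero (Comp Fst Snd)))))).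

Fixpoint history (q : baire) (k : nat) : nat :=
  if k is k'.+1 then cpair (history q k') (q k') else 0.

Lemma history_agree q q' k :
  history q k = history q' k -> forall i, i < k -> q i = q' i.
Proof.
elim: k => // k IH /= /cpair_inj[/IH{}IH e] i.
by rewrite ltnS leq_eqVlt => /orP[/eqP->|/IH].
Qed.

Lemma eval_cid p n : eval p cid n n.
Proof.
exists (cfst n), (csnd n); split=> //.
by rewrite /cpair /cfst /csnd -surjective_pairing Cantor.cancel_to_of.
Qed.

Lemma eval_cadd p n k : eval p cadd (cpair n k) (n + k).
Proof.
rewrite /= cfst_pair csnd_pair.
elim: k => [|k IH]; first by rewrite addn0; apply: eval_cid.
exists (n + k) => //; exists (n + k); last by rewrite addnS.
by exists (cpair k (n + k)); rewrite csnd_pair.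
Qed.

Lemma eval_cdbl p n : eval p cdbl n n.*2.
Proof.
exists (cpair n n); last by rewrite -addnn; apply: eval_cadd.
by exists n, n; split=> //; apply: eval_cid.
Qed.

Lemma eval_cleft a q n : eval (join a q) cleft n (a n).
Proof.
exists n.*2; first exact: eval_cdbl.
by rewrite /= /join odd_double doubleK.
Qed.

Lemma eval_cright a q n : eval (join a q) cright n (q n).
Proof.
exists n.*2.+1; first by exists n.*2 => //; apply: eval_cdbl.
by rewrite /= /join /= odd_double uphalf_double.
Qed.

Lemma eval_chistory a q n k : eval (join a q) chistory (cpair n k) (history q k).
Proof.
rewrite /chistory /= csnd_pair cfst_pair.
elim: k => // k IH; exists (history q k) => //.
exists (history q k), (q k); split=> //.
  by exists (cpair k (history q k)); rewrite !csnd_pair.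
exists k; last exact: eval_cright.
by exists (cpair k (history q k)); rewrite ?csnd_pair ?cfst_pair.
Qed.

Lemma continuous_pmap_oracle F : continuous_pmap F ->
  exists c a, forall q r, F q r -> machine_fun c (join a q) r.
Proof.
move=> Fc; exists cassoc.
pose P x := let n := cfst (cfst x) in let j := csnd (cfst x) in
  forall q r, F q r -> history q (cfst j) = csnd x -> r n = csnd j.
exists (fun x => if `[< P x >] then 0 else 1) => q r Fqr n.
set a := (fun x => _).
pose t j := a (cpair (cpair n j) (history q (cfst j))).
have t0 j : t j = 0 -> r n = csnd j.
  rewrite /t /a; case: asboolP => // + _.
  by rewrite /P !(cfst_pair, csnd_pair) => /(_ _ _ Fqr); apply.
have body j : eval (join a q)
    (Comp cleft (Pair cid (Comp chistory (Pair Zero (Comp Fst Snd)))))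
    (cpair n j) (t j).
  exists (cpair (cpair n j) (history q (cfst j))); last exact: eval_cleft.
  exists (cpair n j), (history q (cfst j)); split=> //; first exact: eval_cid.
  exists (cpair 0 (cfst j)); last exact: eval_chistory.
  by exists 0, (cfst j); split=> //; exists j; rewrite //= csnd_pair.
have ex : exists j, t j == 0.
  have [k hk] := Fc _ _ Fqr n; exists (cpair k (r n)).
  rewrite /t /a asboolT // /P !(cfst_pair, csnd_pair) => q' r' F' e.
  exact: hk F' (history_agree e).
have [j /eqP tj jmin] := find_ex_minn ex.
exists j; last by rewrite /= (t0 _ tj).
split=> [|i lt]; first by have := body j; rewrite tj.
have := body i; case e: (t i) => [|u]; last by exists u.
by have := jmin i; rewrite e eqxx leqNgt lt => /(_ isT).
Qed.

End Associate.

Section FunctionSpace.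
Variables X Y : repSpace.

Definition cfun : Type := {f : X -> Y | continuously_realisable f}.

(* The machine reads the parameter [tail p] and the argument [q] through the
   single oracle [join (tail p) q]. *)
Definition fun_names (p : baire) (f : cfun) : Prop :=
  exists2 c, p 0 = index c &
    realises (fun q r => machine_fun c (join (tail p) q) r) (sval f).

Lemma fun_names_inj p f g : fun_names p f -> fun_names p g -> f = g.
Proof.
case: f g => [f hf] [g hg] [c pc cf] [d]; rewrite pc => /index_inj<- cg.
apply: eq_exist; apply: funext => x; have [q qx] := names_surj x.
have [r qr rf] := cf _ _ qx; have [s qs sg] := cg _ _ qx.
by apply: names_inj rf _; rewrite (machine_fun_inj qr qs).
Qed.

Lemma fun_names_surj f : exists p, fun_names p f.
Proof.
case: f => [f hf]; have [F /continuous_pmap_oracle[c [a ca]] Ff] := hf.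
exists (fun n => if n is m.+1 then a m else index c); exists c => //= q x qx.
by have [r /ca qr rf] := Ff _ _ qx; exists r.
Qed.

Definition funSpace : repSpace := RepSpace fun_names_inj fun_names_surj.

End FunctionSpace.

Definition opens (X : repSpace) : repSpace := funSpace X sierpSpace.

Definition open_set (X : repSpace) (U : opens X) : set X :=
  [set x | sval U x = true].

Definition computably_open (X : repSpace) (A : set X) : Prop :=
  exists2 U : opens X, computable_point U & open_set U = A.

Definition computably_discrete (X : repSpace) : Prop :=
  @computably_open (prodSpace X X) [set z | z.1 = z.2].

Definition computably_overt (X : repSpace) : Prop :=
  @computably_open (opens X) [set U | open_set U !=set0].

Section Ideals.
Variable R : nat -> nat -> Prop.

Definition is_ideal (I : set nat) : Prop :=
  [/\ I !=set0,
      forall x y, R x y -> I y -> I x &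
      forall x y, I x -> I y -> exists z, [/\ I z, R x z & R y z]].

Definition ideal : Type := {I : set nat | is_ideal I}.

Definition ideal_names (p : baire) (I : ideal) : Prop := sval I = range p.

Lemma ideal_names_inj p I J : ideal_names p I -> ideal_names p J -> I = J.
Proof.
case: I J => [I hI] [J hJ]; rewrite /ideal_names /= => eI eJ.
by apply: eq_exist; rewrite eI eJ.
Qed.

Lemma ideal_names_surj I : exists p, ideal_names p I.
Proof.
case: I => [I hI]; have [[i Ii] _ _] := hI.
exists (fun k => if `[< I k >] then k else i).
apply/seteqP; split=> [k Ik|_ [k _ <-]] /=; last by case: asboolP.
by exists k => //; rewrite asboolT.
Qed.

Definition idealSpace : repSpace := RepSpace ideal_names_inj ideal_names_surj.

End Ideals.

Definition precomputably_quasi_Polish (X : repSpace) : Prop :=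
  exists R : nat -> nat -> Prop,
    [/\ forall x y z, R x y -> R y z -> R x z, ce_rel R &
        computably_isomorphic X (idealSpace R)].

Definition computably_quasi_Polish (X : repSpace) : Prop :=
  precomputably_quasi_Polish X /\ computably_overt X.

(* Main.v *)
Require Import Defs.
From mathcomp Require Import all_boot.
From mathcomp Require Import boolp classical_sets cardinality.
From mathcomp Require Import zify.

(** Let [u] be the partial computable map sending [n] to the output, on input 0
    and with oracle constantly [n], of the machine of index [n]. Let X be the
    quotient of the naturals by the equivalence relation [R] generated by
    [n R u n], a name of a class being any sequence whose head lies in the class.
    Since [R] is c.e., equality on X is semidecidable, X is overt, and its points
    are exactly the ideals of the (transitive) relation [R] itself. Two distinct
    indices outside the domain of [u] are inequivalent, so X is infinite. If a
    computable [f] on X satisfied [f a < f b], let [e] be the index of a machine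
    computing [n |-> if f n <= f a then b else a]; as [e R u e], the two numbers
    [f e] and [f (u e)] agree, which is absurd in both cases. *)

Set Implicit Arguments.
Unset Strict Implicit.
Unset Printing Implicit Defensive.

Local Open Scope classical_set_scope.

(** * Total computable operations relative to an oracle *)

(** A single machine serves all oracles, so names can be passed in as the oracle. *)
Definition computable_op (f : baire -> nat -> nat) : Prop :=
  exists c, forall p n, eval p c n (f p n).

Lemma cpairK n : cpair (cfst n) (csnd n) = n.
Proof.
by rewrite /cpair /cfst /csnd -surjective_pairing Cantor.cancel_to_of.
Qed.

Lemma computable_id : computable_op (fun=> id).
Proof.
by exists (Pair Fst Snd) => p n; exists (cfst n), (csnd n); rewrite cpairK.
Qed.

Lemma computable_comp f g : computable_op f -> computable_op g ->
  computable_op (fun p n => f p (g p n)).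
Proof.
by move=> [c cf] [d dg]; exists (Comp c d) => p n; exists (g p n).
Qed.

Lemma computable_const k : computable_op (fun _ _ => k).
Proof.
elim: k => [|k [c ck]]; first by exists Zero.
by exists (Comp Succ c) => p n; exists k.
Qed.

Lemma computable_succ f : computable_op f -> computable_op (fun p n => (f p n).+1).
Proof. by apply: (@computable_comp (fun=> succn)); exists Succ. Qed.

Lemma computable_fst f :
  computable_op f -> computable_op (fun p n => cfst (f p n)).
Proof. by apply: (@computable_comp (fun=> cfst)); exists Fst. Qed.

Lemma computable_snd f :
  computable_op f -> computable_op (fun p n => csnd (f p n)).
Proof. by apply: (@computable_comp (fun=> csnd)); exists Snd. Qed.

Lemma computable_oracle f :
  computable_op f -> computable_op (fun p n => p (f p n)).
Proof. by apply: (@computable_comp (fun p => p)); exists Oracle. Qed.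

Lemma computable_pair f g : computable_op f -> computable_op g ->
  computable_op (fun p n => cpair (f p n) (g p n)).
Proof.
by move=> [c cf] [d dg]; exists (Pair c d) => p n; exists (f p n), (g p n).
Qed.

Lemma computable_comp2 (h : baire -> nat -> nat -> nat) f g :
  computable_op (fun p m => h p (cfst m) (csnd m)) ->
  computable_op f -> computable_op g ->
  computable_op (fun p n => h p (f p n) (g p n)).
Proof.
move=> hh hf hg; have := computable_comp hh (computable_pair hf hg).
congr computable_op; apply: funext => p; apply: funext => n.
by rewrite cfst_pair csnd_pair.
Qed.

(** The input [n] is carried along as the parameter of [Prec], so base, step and bound may all
    depend on it. *)
Lemma computable_primrec (h : baire -> nat -> nat -> nat) b
    (g : baire -> nat -> nat -> nat -> nat) k :
  (forall p n, h p n 0 = b p n) ->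
  (forall p n i, h p n i.+1 = g p n i (h p n i)) ->
  computable_op b ->
  computable_op (fun p m => g p (cfst m) (cfst (csnd m)) (csnd (csnd m))) ->
  computable_op k -> computable_op (fun p n => h p n (k p n)).
Proof.
move=> h0 hS [c cb] [d dg]; apply: (@computable_comp2 h) computable_id.
exists (Prec c d) => p m /=; elim: (csnd m) => [|i IH]; first by rewrite h0.
exists (h p (cfst m) i) => //; have := dg p (cpair (cfst m) (cpair i (h p (cfst m) i))).
by rewrite !(cfst_pair, csnd_pair) hS.
Qed.

Lemma computable_natrec (h : nat -> nat) b (g : nat -> nat -> nat) f :
  h 0 = b -> (forall i, h i.+1 = g i (h i)) ->
  computable_op (fun _ m => g (cfst m) (csnd m)) ->
  computable_op f -> computable_op (fun p n => h (f p n)).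
Proof.
move=> h0 hS hg; apply: (@computable_primrec (fun _ _ => h) (fun _ _ => b)
  (fun _ _ => g)) => //; first exact: computable_const.
apply: (@computable_comp (fun _ m => g (cfst m) (csnd m))) => //.
exact/computable_snd/computable_id.
Qed.

(** Case distinction is primitive recursion on the boolean read as 0 or 1. *)
Lemma computable_if (b : baire -> nat -> bool) f g :
  computable_op b -> computable_op f -> computable_op g ->
  computable_op (fun p n => if b p n then f p n else g p n).
Proof.
move=> hb hf hg.
have := @computable_primrec
  (fun p n k => if k is _.+1 then f p n else g p n) g (fun p n _ _ => f p n) b.
have -> : (fun p n => if b p n then f p n else g p n) =
  (fun p n => match (b p n : nat) with 0 => g p n | _.+1 => f p n end).
  by apply: funext => p; apply: funext => n; case: (b p n).
apply=> //; apply: (computable_comp hf); exact/computable_fst/computable_id.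
Qed.

Lemma computable_pred f :
  computable_op f -> computable_op (fun p n => (f p n).-1).
Proof.
apply: (@computable_natrec predn 0 (fun i _ => i)) => //.
exact/computable_fst/computable_id.
Qed.

Lemma computable_add f g : computable_op f -> computable_op g ->
  computable_op (fun p n => f p n + g p n).
Proof.
move=> hf; apply: (@computable_primrec (fun p n k => f p n + k) f
  (fun _ _ _ r => r.+1)) => // [p n|p n i|]; rewrite ?addn0 ?addnS //.
exact/computable_succ/computable_snd/computable_snd/computable_id.
Qed.

Lemma computable_double f :
  computable_op f -> computable_op (fun p n => (f p n).*2).
Proof.
move=> hf; have := computable_add hf hf.
by congr computable_op; apply: funext => p; apply: funext => n; rewrite addnn.
Qed.

Lemma computable_sub f g : computable_op f -> computable_op g ->
  computable_op (fun p n => f p n - g p n).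
Proof.
move=> hf; apply: (@computable_primrec (fun p n k => f p n - k) f
  (fun _ _ _ r => r.-1)) => // [p n|p n i|]; rewrite ?subn0 ?subnS //.
exact/computable_pred/computable_snd/computable_snd/computable_id.
Qed.

Lemma computable_leq f g : computable_op f -> computable_op g ->
  computable_op (fun p n => f p n <= g p n).
Proof.
move=> hf hg; rewrite /leq.
apply: (@computable_natrec (fun i => i == 0) 1 (fun _ _ => 0)) => //.
  exact: computable_const.
exact: computable_sub.
Qed.

Lemma computable_eq f g : computable_op f -> computable_op g ->
  computable_op (fun p n => f p n == g p n).
Proof.
move=> hf hg.
have -> : (fun p n => (f p n == g p n) : nat) =
    (fun p n => f p n - g p n + (g p n - f p n) <= 0).
  by apply: funext => p; apply: funext => n; congr nat_of_bool; lia.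
by apply: computable_leq; [apply: computable_add; apply: computable_sub|
  apply: computable_const].
Qed.

Lemma computable_mod4 f :
  computable_op f -> computable_op (fun p n => f p n %% 4).
Proof.
apply: (@computable_natrec (fun i => i %% 4) 0
  (fun _ r => if r == 3 then 0 else r.+1)) => // [i|].
  by case: eqP; lia.
have h : computable_op (fun _ m => csnd m) by apply/computable_snd/computable_id.
apply: computable_if; [apply: computable_eq| |exact: computable_succ] => //;
  exact: computable_const.
Qed.

Lemma computable_div4 f :
  computable_op f -> computable_op (fun p n => f p n %/ 4).
Proof.
apply: (@computable_natrec (fun i => i %/ 4) 0
  (fun i r => r + (i %% 4 == 3))) => // [i|].
  by case: eqP; lia.
have h := computable_id.
apply: computable_add; first exact: computable_snd.
apply: computable_eq; last exact: computable_const.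
exact/computable_mod4/computable_fst.
Qed.

Lemma computable_odd f :
  computable_op f -> computable_op (fun p n => odd (f p n)).
Proof.
apply: (@computable_natrec odd 0 (fun _ r => 1 - r)) => // [i|].
  by rewrite /=; case: odd.
by apply: computable_sub; [apply: computable_const|
  apply/computable_snd/computable_id].
Qed.

Lemma computable_half f :
  computable_op f -> computable_op (fun p n => (f p n)./2).
Proof.
apply: (@computable_natrec half 0 (fun i r => odd i + r)) => // [i|].
  exact: uphalf_half.
have h := computable_id.
by apply: computable_add; [apply/computable_odd/computable_fst|
  apply: computable_snd].
Qed.

Ltac solve_computable :=
  repeat first
  [ assumption
  | lazymatch goal with
    | |- computable_op (fun _ n => n) => exact: computable_id
    | |- computable_op (fun _ _ => cfst _) => apply: computable_fst
    | |- computable_op (fun _ _ => csnd _) => apply: computable_snd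
    | |- computable_op (fun _ _ => cpair _ _) => apply: computable_pair
    | |- computable_op (fun _ _ => if _ then _ else _) => apply: computable_if
    | |- computable_op (fun _ _ => nat_of_bool (_ == _)) => apply: computable_eq
    | |- computable_op (fun _ _ => nat_of_bool (_ <= _)) => apply: computable_leq
    | |- computable_op (fun _ _ => nat_of_bool (odd _)) => apply: computable_odd
    | |- computable_op (fun _ _ => _.*2) => apply: computable_double
    | |- computable_op (fun _ _ => _./2) => apply: computable_half
    | |- computable_op (fun _ _ => _ %% 4) => apply: computable_mod4
    | |- computable_op (fun _ _ => _ %/ 4) => apply: computable_div4
    | |- computable_op (fun _ _ => _ - _) => apply: computable_sub
    | |- computable_op (fun _ _ => _ + _) => apply: computable_add
    | |- computable_op (fun _ _ => _.-1) => apply: computable_pred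
    | |- computable_op (fun _ _ => ?k) => exact: computable_const
    | |- computable_op (fun _ _ => _.+1) => apply: computable_succ
    | |- computable_op (fun p _ => p _) => apply: computable_oracle
    end ].

(** * A step-by-step interpreter for the machines *)

(** The successor keeps non-empty stacks apart from 0. *)
Definition push (t d K : nat) : nat := (cpair (cpair t d) K).+1.

(* States are [cpair K v], with [v] the current value and [K] a stack of
   frames: 0 is the empty stack. Frame [cpair t d] acts on [v] as follows:
   - t = 0: replace [v] by the value of the machine of index [d] on [v];
   - t = 1: replace [v] by [cpair d v];
   - t = 2, d = cpair i n: replace [v] by [cpair v w], where [w] is the value of
     machine [i] on [n];
   - t = 3, d = cpair i (cpair n j): [v] is the value of machine [i] on
     [cpair n j], in a search for the first [j] where it is 0. *)
Definition exec (o : baire) (K v d : nat) : nat :=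
  let a := (d - 5) %/ 4 in
  if d == 0 then cpair K 0 else
  if d == 1 then cpair K v.+1 else
  if d == 2 then cpair K (cfst v) else
  if d == 3 then cpair K (csnd v) else
  if d == 4 then cpair K (o v) else
  if (d - 5) %% 4 == 0 then
    cpair (push 0 (cfst a) (push 2 (cpair (csnd a) v) K)) v else
  if (d - 5) %% 4 == 1 then
    cpair (push 0 (csnd a) (push 0 (cfst a) K)) v else
  if (d - 5) %% 4 == 2 then
    if csnd v == 0 then cpair (push 0 (cfst a) K) (cfst v) else
    cpair (push 0 d (push 1 (csnd v).-1 (push 1 (cfst v) (push 0 (csnd a) K))))
      (cpair (cfst v) (csnd v).-1)
  else cpair (push 0 a (push 3 (cpair a (cpair v 0)) K)) (cpair v 0).

Definition step (o : baire) (st : nat) : nat :=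
  let v := csnd st in
  let F := cfst (cfst st).-1 in let K := csnd (cfst st).-1 in
  let d := csnd F in
  if cfst st == 0 then st else
  if cfst F == 0 then exec o K v d else
  if cfst F == 1 then cpair K (cpair d v) else
  if cfst F == 2 then cpair (push 0 (cfst d) (push 1 v K)) (csnd d) else
  if v == 0 then cpair K (csnd (csnd d)) else
  let m := cpair (cfst (csnd d)) (csnd (csnd d)).+1 in
  cpair (push 0 (cfst d) (push 3 (cpair (cfst d) m) K)) m.

(** The simulated oracle may vary with the input [n], as later searches run one machine on many
    oracles. *)
Lemma computable_step (o : baire -> nat -> baire) f :
  computable_op (fun p m => o p (cfst m) (csnd m)) -> computable_op f ->
  computable_op (fun p n => step (o p n) (f p n)).
Proof.
move=> ho hf; rewrite /step /exec /push /=.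
have hov : computable_op (fun p n => o p n (csnd (f p n))).
  by apply: computable_comp2 ho _ _; solve_computable.
by solve_computable.
Qed.

Definition sim (o : baire) (i n s : nat) : nat :=
  iter s (step o) (cpair (push 0 i 0) n).

Lemma computable_sim (o : baire -> nat -> baire) i f s :
  computable_op (fun p m => o p (cfst m) (csnd m)) ->
  computable_op i -> computable_op f -> computable_op s ->
  computable_op (fun p n => sim (o p n) (i p n) (f p n) (s p n)).
Proof.
move=> ho hi hf.
apply: (@computable_primrec (fun p n k => sim (o p n) (i p n) (f p n) k)
  (fun p n => cpair (push 0 (i p n) 0) (f p n))
  (fun p n _ r => step (o p n) r)) => //.
  by rewrite /push; solve_computable.
apply: (@computable_step (fun p m => o p (cfst m))); last by solve_computable.
by apply: computable_comp2 ho _ _; solve_computable.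
Qed.

(** * Correctness of the interpreter *)

Section Simulation.
Variable o : baire.

Lemma step_run d K v : step o (cpair (push 0 d K) v) = exec o K v d.
Proof. by rewrite /step /push !(cfst_pair, csnd_pair, succnK). Qed.

Lemma step_pairl d K v : step o (cpair (push 1 d K) v) = cpair K (cpair d v).
Proof. by rewrite /step /push !(cfst_pair, csnd_pair, succnK). Qed.

Lemma step_pairr i n K v :
  step o (cpair (push 2 (cpair i n) K) v) = cpair (push 0 i (push 1 v K)) n.
Proof. by rewrite /step /push !(cfst_pair, csnd_pair, succnK). Qed.

Lemma step_mu i n j K v : step o (cpair (push 3 (cpair i (cpair n j)) K) v) =
  if v == 0 then cpair K j else
  cpair (push 0 i (push 3 (cpair i (cpair n j.+1)) K)) (cpair n j.+1).
Proof. by rewrite /step /push !(cfst_pair, csnd_pair, succnK). Qed.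

Lemma div4_index t a : 4 < t < 9 ->
  ((t + 4 * a - 5) %/ 4 = a) * ((t + 4 * a - 5) %% 4 = t - 5).
Proof. by move=> lt; split; lia. Qed.

Lemma exec_pair c1 c2 K v : exec o K v (Defs.index (Pair c1 c2)) =
  cpair (push 0 (Defs.index c1) (push 2 (cpair (Defs.index c2) v) K)) v.
Proof. by rewrite /exec !(@div4_index 5) //= !(cfst_pair, csnd_pair). Qed.

Lemma exec_comp c1 c2 K v : exec o K v (Defs.index (Comp c1 c2)) =
  cpair (push 0 (Defs.index c2) (push 0 (Defs.index c1) K)) v.
Proof. by rewrite /exec !(@div4_index 6) //= !(cfst_pair, csnd_pair). Qed.

Lemma exec_prec c1 c2 K v : exec o K v (Defs.index (Prec c1 c2)) =
  if csnd v == 0 then cpair (push 0 (Defs.index c1) K) (cfst v) else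
  cpair (push 0 (Defs.index (Prec c1 c2))
    (push 1 (csnd v).-1 (push 1 (cfst v) (push 0 (Defs.index c2) K))))
    (cpair (cfst v) (csnd v).-1).
Proof. by rewrite /exec !(@div4_index 7) //= !(cfst_pair, csnd_pair). Qed.

Lemma exec_mu c K v : exec o K v (Defs.index (Mu c)) =
  cpair (push 0 (Defs.index c)
    (push 3 (cpair (Defs.index c) (cpair v 0)) K)) (cpair v 0).
Proof. by rewrite /exec !(@div4_index 8). Qed.

Definition reaches (st st' : nat) : Prop := exists s, iter s (step o) st = st'.

Lemma reaches_refl st : reaches st st.
Proof. by exists 0. Qed.

Lemma reaches_trans b a c : reaches a b -> reaches b c -> reaches a c.
Proof. by move=> [s <-] [t <-]; exists (t + s); rewrite iterD. Qed.

Lemma reaches_step a c : reaches (step o a) c -> reaches a c.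
Proof. by apply: reaches_trans; exists 1. Qed.

(** The arbitrary stack [K] lets the induction hypotheses apply to subcomputations, which run above
    pending frames. *)
Lemma eval_reaches c n v K :
  eval o c n v -> reaches (cpair (push 0 (Defs.index c) K) n) (cpair K v).
Proof.
have rK := reaches_refl.
elim: c n v K => [|||||c1 IH1 c2 IH2|c1 IH1 c2 IH2|c1 IH1 c2 IH2|c1 IH1] n v K;
  try by move=> /= ->; apply: reaches_step; rewrite step_run.
- move=> [v1 [v2 [h1 h2 ->]]]; apply: reaches_step; rewrite step_run exec_pair.
  apply: reaches_trans (IH1 _ _ _ h1) _; apply: reaches_step; rewrite step_pairr.
  apply: reaches_trans (IH2 _ _ _ h2) _; apply: reaches_step.
  by rewrite step_pairl.
- move=> [m h2 h1]; apply: reaches_step; rewrite step_run exec_comp.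
  exact: reaches_trans (IH2 _ _ _ h2) (IH1 _ _ _ h1).
(* Splitting the input makes the state follow the induction on the recursion count. *)
- rewrite -[n in cpair _ n]cpairK /=.
  elim: (csnd n) v K => [|k IHk] v K h; apply: reaches_step;
    rewrite step_run exec_prec !(cfst_pair, csnd_pair) /=; first exact: IH1.
  case: h => r /IHk h1 h2; apply: reaches_trans (h1 _) _.
  apply: reaches_step; rewrite step_pairl.
  by apply: reaches_step; rewrite step_pairl; apply: IH2.
- move=> [h0 hS]; apply: reaches_step; rewrite step_run exec_mu.
  have loop j : j <= v -> reaches (cpair (push 0 (Defs.index c1)
     (push 3 (cpair (Defs.index c1) (cpair n j)) K)) (cpair n j)) (cpair K v).
    move: {1}(v - j) (erefl (v - j)) => d; elim: d j => [|d IHd] j e le.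
      have -> : j = v by lia.
      apply: reaches_trans (IH1 _ _ _ h0) _.
      by apply: reaches_step; rewrite step_mu.
    have [|u hu] := hS j; first by lia.
    apply: reaches_trans (IH1 _ _ _ hu) _.
    by apply: reaches_step; rewrite step_mu; apply: IHd; lia.
  exact: loop.
Qed.

Definition halts_in (s st : nat) : Prop := cfst (iter s (step o) st) = 0.

Lemma halts_in_push s t d K v : halts_in s (cpair (push t d K) v) ->
  exists2 s', s = s'.+1 & halts_in s' (step o (cpair (push t d K) v)).
Proof.
by case: s => [|s]; rewrite /halts_in ?iterSr /= ?cfst_pair //; exists s.
Qed.

(** To empty the stack, a run must first deliver the value of the top frame to [K]. The strict
    decrease of the remaining time supports the induction for [Mu]. *)
Lemma halts_eval s c n K : halts_in s (cpair (push 0 (Defs.index c) K) n) ->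
  exists v s', [/\ s' < s, eval o c n v & halts_in s' (cpair K v)].
Proof.
elim: c s n K => [|||||c1 IH1 c2 IH2|c1 IH1 c2 IH2|c1 IH1 c2 IH2|c1 IH1] s n K;
  move=> /halts_in_push[{}s -> h]; rewrite step_run in h;
  try by move: h; rewrite /exec /=; eexists; exists s; split; last exact: h.
- rewrite exec_pair in h; have [v1 [s1 [lt1 e1 {h}]]] := IH1 _ _ _ h.
  move=> /halts_in_push[s2 es]; rewrite step_pairr => h.
  have [v2 [s3 [lt3 e3 {h}]]] := IH2 _ _ _ h.
  move=> /halts_in_push[s4 es4]; rewrite step_pairl => h.
  exists (cpair v1 v2), s4; split=> //; first by lia.
  by exists v1, v2.
- rewrite exec_comp in h; have [v2 [s2 [lt2 e2 {}h]]] := IH2 _ _ _ h.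
  have [v1 [s1 [lt1 e1 {}h]]] := IH1 _ _ _ h.
  by exists v1, s1; split=> //; [lia|exists v2].
- rewrite exec_prec in h; rewrite [eval _ _]/=; move: h.
  elim: (csnd n) s K => [|k IHk] s K /= h.
    have [v [s' [lt e {}h]]] := IH1 _ _ _ h.
    by exists v, s'; split=> //; lia.
  move: h => /halts_in_push[s' -> h].
  rewrite step_run exec_prec !(cfst_pair, csnd_pair) in h.
  have [r [s1 [lt1 e1 {h}]]] := IHk _ _ h.
  move=> /halts_in_push[s2 es2]; rewrite step_pairl.
  move=> /halts_in_push[s3 es3]; rewrite step_pairl => h.
  have [v [s4 [lt4 e4 {}h]]] := IH2 _ _ _ h.
  by exists v, s4; split=> //; [lia|exists r].
- rewrite exec_mu in h.
  (* The search has no bound known in advance, so the induction is on the time left, with the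
     earlier values known to be positive. *)
  have loop j t : (forall i, i < j -> exists u, eval o c1 (cpair n i) u.+1) ->
    halts_in t (cpair (push 0 (Defs.index c1)
     (push 3 (cpair (Defs.index c1) (cpair n j)) K)) (cpair n j)) ->
    exists v s', [/\ s' < t, eval o (Mu c1) n v & halts_in s' (cpair K v)].
    elim/ltn_ind: t j => t IHt j lt_j /IH1[v [s1 [lt1 e1]]].
    move=> /halts_in_push[s2 es2]; rewrite step_mu.
    case: v e1 => [|u] e1 /= ht; first by exists j, s2; split=> //; lia.
    have [|i|v [s3 [lt3 e3 h3]]] := IHt s2 _ j.+1 _ ht; first by lia.
      rewrite ltnS leq_eqVlt => /orP[/eqP->|/lt_j//]; by exists u.
    by exists v, s3; split=> //; lia.
  have [//|v [s' [lt e {}h]]] := loop 0 s _ h.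
  by exists v, s'; split=> //; lia.
Qed.

Lemma step_halted st : cfst st = 0 -> step o st = st.
Proof. by rewrite /step => ->. Qed.

Lemma sim_halted i n s s' : s <= s' ->
  cfst (sim o i n s) = 0 -> sim o i n s' = sim o i n s.
Proof.
move=> /subnK<- h; rewrite /sim iterD -/(sim o i n s).
by elim: (s' - s) => //= k ->; apply: step_halted.
Qed.

(** With the step bound as an extra input, halting becomes decidable and usable inside total
    operations. *)
Lemma eval_sim c n v : eval o c n v <->
  exists2 s, cfst (sim o (Defs.index c) n s) = 0 & csnd (sim o (Defs.index c) n s) = v.
Proof.
split=> [/(eval_reaches 0)[s e]|[s h <-]].
  by exists s; rewrite /sim e ?cfst_pair ?csnd_pair.
have [v' [_ [_ e _]]] := halts_eval h.
have [t et] := eval_reaches 0 e.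
(* Halted states are fixed, so the results at times [s] and [t] agree whichever is earlier. *)
have [le|/ltnW le] := leqP s t.
  by rewrite -(sim_halted le h) /sim et csnd_pair.
rewrite (@sim_halted _ _ t s) // /sim et ?csnd_pair ?cfst_pair //.
Qed.

End Simulation.

(** * Continuity of machines and a criterion for open sets *)

(** A halting run queries the oracle finitely often: the bounds of its subcomputations are added up,
    over all rounds of a loop. *)
Lemma eval_continuous p c n v : eval p c n v ->
  exists k, forall p', (forall i, i < k -> p' i = p i) -> eval p' c n v.
Proof.
elim: c n v => [|||||c1 IH1 c2 IH2|c1 IH1 c2 IH2|c1 IH1 c2 IH2|c1 IH1] n v /=;
  try by move=> ->; exists 0.
- by move=> ->; exists n.+1 => p' ->.
- move=> [v1 [v2 [/IH1[k1 h1] /IH2[k2 h2] ->]]].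
  exists (k1 + k2) => p' e; exists v1, v2.
  by split=> //; [apply: h1|apply: h2] => i lt; apply: e; lia.
- move=> [m /IH2[k2 h2] /IH1[k1 h1]]; exists (k1 + k2) => p' e; exists m.
    by apply: h2 => i lt; apply: e; lia.
  by apply: h1 => i lt; apply: e; lia.
- elim: (csnd n) v => [|j IHj] v /=; first exact: IH1.
  move=> [r /IHj[k1 h1] /IH2[k2 h2]]; exists (k1 + k2) => p' e; exists r.
    by apply: h1 => i lt; apply: e; lia.
  by apply: h2 => i lt; apply: e; lia.
- move=> [/IH1[k0 h0] hS].
  have [k hk] : exists k, forall p', (forall i, i < k -> p' i = p i) ->
      forall j, j < v -> exists u, eval p' c1 (cpair n j) u.+1.
    elim: v hS {h0} => [|v IHv] hS; first by exists 0.
    have [|k1 h1] := IHv; first by move=> j lt; apply: hS; lia.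
    have [u /IH1[k2 h2]] := hS v (ltnSn v); exists (k1 + k2) => p' e j.
    rewrite ltnS leq_eqVlt => /orP[/eqP->|].
      by exists u; apply: h2 => i lt; apply: e; lia.
    by apply: h1 => i lt; apply: e; lia.
  exists (k0 + k) => p' e; split; first by apply: h0 => i lt; apply: e; lia.
  by apply: hk => i lt; apply: e; lia.
Qed.

Lemma continuous_machine_fun c a :
  continuous_pmap (fun p q => machine_fun c (join a p) q).
Proof.
move=> p q h n; have [k hk] := eval_continuous (h n).
exists k => p' q' h' e; apply: eval_fun (h' n) _; apply: hk => i lt.
by rewrite /join; case: odd => //; apply: e; lia.
Qed.

(** The sequence [T p] is itself a Sierpinski name of the truth value of [A x]. A machine for an
    open set finds its argument at the odd positions of the oracle, hence [odds]. *)
Lemma computably_openP (X : repSpace) (A : set X) (T : baire -> nat -> nat) :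
  computable_op (fun p => T (odds p)) ->
  (forall p x, names p x -> A x <-> exists n, T p n <> 0) ->
  computably_open A.
Proof.
move=> [c hc] hT; pose f (x : X) : sierpSpace := `[< A x >].
have hf a : realises (fun p q => machine_fun c (join a p) q) f.
  move=> p x px; exists (T p); first by move=> n; have := hc (join a p) n; rewrite odds_join.
  rewrite /= /sierp_names -(hT _ _ px); split=> [/asboolP//|Ax]; exact/asboolP.
have cf : continuously_realisable f.
  by exists (fun p q => machine_fun c (join (fun=> 0) p) q); [apply: continuous_machine_fun|].
exists (exist _ f cf : opens X); last first.
  by apply/seteqP; split=> x /=; rewrite /open_set /= => /asboolP.
exists (fun n => if n == 0 then Defs.index c else 0); last by exists c.
have [d hd] : computable_op (fun _ n => if n == 0 then Defs.index c else 0).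
  by solve_computable.
by exists d => n; apply: hd.
Qed.

(** * The quotient of the naturals by a c.e. equivalence relation *)

Section CeerSpace.
Variables (R : nat -> nat -> Prop) (t : nat -> nat -> nat -> bool).
Hypothesis R_refl : forall x, R x x.
Hypothesis R_sym : forall x y, R x y -> R y x.
Hypothesis R_trans : forall x y z, R x y -> R y z -> R x z.
Hypothesis R_t : forall x y, R x y <-> exists w, t x y w.
Hypothesis computable_t :
  computable_op (fun _ m => t (cfst m) (cfst (csnd m)) (csnd (csnd m))).

Lemma computable_test f g h :
  computable_op f -> computable_op g -> computable_op h ->
  computable_op (fun p n => t (f p n) (g p n) (h p n)).
Proof.
move=> hf hg hh.
have := computable_comp computable_t (computable_pair hf (computable_pair hg hh)).
congr computable_op; apply: funext => p; apply: funext => n.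
by rewrite !(cfst_pair, csnd_pair).
Qed.

(** [Mu] looks for the first zero of [1 - t], which is the first witness. *)
Lemma ce_ceer : ce_rel R.
Proof.
have [c hc] : computable_op (fun _ m =>
    1 - t (cfst (cfst m)) (csnd (cfst m)) (csnd m)).
  apply: computable_sub; first exact: computable_const.
  by apply: computable_test; solve_computable.
have hT x y w : eval (fun=> 0) c (cpair (cpair x y) w) (1 - t x y w).
  by have := hc (fun=> 0) (cpair (cpair x y) w); rewrite !(cfst_pair, csnd_pair).
exists (Mu c) => x y; rewrite R_t; split=> [ex|[v [h _]]]; last first.
  by exists v; have := eval_fun h (hT x y v); case: (t x y v).
have [w tw wmin] := find_ex_minn ex; exists w; split.
  by have := hT x y w; rewrite tw.
move=> j lt; exists 0; have := hT x y j; case E: (t x y j) => //.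
by have := wmin j E; lia.
Qed.

(** Two members of an ideal lie below a common third, so by symmetry they are equivalent: an ideal
    is a single class. *)
Lemma ideal_class (I : ideal R) x y : sval I x -> sval I y <-> R x y.
Proof.
case: I => I [_ Idown Idir] /= Ix; split=> [Iy|/R_sym Ryx]; last exact: Idown Ryx Ix.
have [z [_ Rxz Ryz]] := Idir _ _ Ix Iy; exact: R_trans Rxz (R_sym Ryz).
Qed.

Lemma class_is_ideal x : is_ideal R (R x).
Proof.
split=> [|y z Ryz /R_trans|y z Ry Rz]; first by exists x; apply: R_refl.
- by apply; apply: R_sym.
- by exists x; split; [apply: R_refl|apply: R_sym|apply: R_sym].
Qed.

Definition class x : ideal R := exist _ (R x : set nat) (class_is_ideal x).

Lemma ideal_eq (I J : ideal R) x : sval I x -> sval J x -> I = J.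
Proof.
move=> Ix Jx; have e : sval I = sval J.
  by apply/funext => y; apply/propext; rewrite (ideal_class y Ix) (ideal_class y Jx).
by case: I J e {Ix Jx} => [I hI] [J hJ] /= e; apply: eq_exist.
Qed.

Lemma class_eq x y : class x = class y <-> R x y.
Proof.
split=> [e|Rxy]; last exact: (@ideal_eq (class x) (class y) y).
by have: sval (class y) y by []; rewrite -e.
Qed.

(** Taking the ideals themselves as points makes the isomorphism with [idealSpace R] the identity on
    points; only the names differ. *)
Definition ceer_names (p : baire) (I : ideal R) : Prop := sval I (p 0).

Lemma ceer_names_inj p I J : ceer_names p I -> ceer_names p J -> I = J.
Proof. exact: ideal_eq. Qed.

Lemma ceer_names_surj I : exists p, ceer_names p I.
Proof. by have [[x Ix] _ _] := proj2_sig I; exists (fun=> x). Qed.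

Definition ceerSpace : repSpace := RepSpace ceer_names_inj ceer_names_surj.

Lemma ceerSpace_discrete : computably_discrete ceerSpace.
Proof.
(* In a name of a pair, [p 0] and [p 1] are the heads of the two components. *)
apply: (@computably_openP (prodSpace ceerSpace ceerSpace) _
  (fun p w => t (p 0) (p 1) w)).
  by rewrite /odds; apply: computable_test; solve_computable.
move=> p [I J] [/= Ip Jp].
have -> : (exists w, (t (p 0) (p 1) w : nat) <> 0) <-> R (p 0) (p 1).
  by rewrite R_t; split=> -[w p0]; exists w; case: t p0 => //.
split=> [e|/(ideal_class _ Ip)/ideal_eq]; last exact.
by apply/(ideal_class _ Ip); rewrite e.
Qed.

Lemma ceerSpace_precomputably_quasi_Polish :
  precomputably_quasi_Polish ceerSpace.
Proof.
exists R; split; [exact: R_trans|exact: ce_ceer|].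
exists id, id; split=> //; last first.
  (* An enumeration of a class is already a name here, since its head is a member. *)
  exists (fun p q => q = p).
    by exists Oracle => p _ -> n.
  move=> p I /= Ip; exists p => //; rewrite /ceer_names Ip.
  by exists 0.
(* Conversely, position [cpair y w] lists [y] if [w] witnesses that [p 0] is related to [y]; the
   default [p 0] stays in the class. *)
pose en (p : baire) m := if t (p 0) (cfst m) (csnd m) then cfst m else p 0.
have [c hc] : computable_op en.
  apply: computable_if; [apply: computable_test|..]; by solve_computable.
exists (fun p q => q = en p); first by exists c => p _ -> n; apply: hc.
move=> p I /= Ip; exists (en p) => //.
apply/seteqP; split=> [y /(ideal_class _ Ip)/R_t[w tw]|_ [m _ <-]].
  by exists (cpair y w); rewrite // /en cfst_pair csnd_pair tw.
rewrite /en; case: ifP => // tw; apply/(ideal_class _ Ip)/R_t.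
by exists (csnd m).
Qed.

(** The constant sequence [n] names the class of [n]. So one searches for [n], a position and a step
    bound for which the machine of [U], run on this name, has halted with a nonzero value. *)
Lemma ceerSpace_overt : computably_overt ceerSpace.
Proof.
pose o (p : baire) n := join (tail p) (fun=> n).
pose st p m := sim (o p (cfst m)) (p 0) (cfst (csnd m)) (csnd (csnd m)).
apply: (@computably_openP (opens ceerSpace) _
  (fun p m => if cfst (st p m) == 0 then csnd (st p m) else 0)).
  have hst : computable_op (fun p m => st (odds p) m).
    rewrite /st; apply: (@computable_sim (fun p m => o (odds p) (cfst m)));
      rewrite ?/o /odds /tail /join; by solve_computable.
  by solve_computable.
move=> p U [d p0 hU]; have hn n := hU (fun=> n) (class n) (R_refl n).
split=> [[I UI]|[m hm]].
  have [[n In] _ _] := proj2_sig I.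
  have eI : class n = I by apply: (@ideal_eq _ _ n).
  have [r hr hs] := hn n; rewrite eI in hs.
  have [k rk] : exists k, r k <> 0 by apply/hs.
  have /eval_sim[s s0 s1] := hr k.
  exists (cpair n (cpair k s)).
  by rewrite /st !(cfst_pair, csnd_pair) p0 s0 s1.
exists (class (cfst m)); have [r hr hs] := hn (cfst m); apply/hs.
exists (cfst (csnd m)); move: hm; case: eqP => // h0 hm.
rewrite -(eval_fun (v := csnd (st p m)) _ (hr _)) //.
apply/eval_sim; exists (csnd (csnd m)); by rewrite -p0.
Qed.

End CeerSpace.

(** * The equivalence relation generated by diagonal evaluation *)

(* One application of the partial function sending the index [n] of a machine
   to its value on input 0 with oracle constantly [n]; [diag s] gives up after
   [s] steps and returns [n]. The constant oracle [n] is a name of the class of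
   [n], so a machine realising a map on classes can be run directly. *)
Definition diag (s n : nat) : nat :=
  let st := sim (fun=> n) n 0 s in if cfst st == 0 then csnd st else n.

Lemma computable_diag f g : computable_op f -> computable_op g ->
  computable_op (fun p n => diag (f p n) (g p n)).
Proof.
move=> hf hg; rewrite /diag /=.
have hst : computable_op (fun p n => sim (fun=> g p n) (g p n) 0 (f p n)).
  apply: (@computable_sim (fun p n _ => g p n)); try by solve_computable.
  by apply: (computable_comp hg); solve_computable.
by solve_computable.
Qed.

Lemma computable_iter_diag k s f :
  computable_op k -> computable_op s -> computable_op f ->
  computable_op (fun p n => iter (k p n) (diag (s p n)) (f p n)).
Proof.
move=> hk hs hf; apply: (@computable_primrec
  (fun p n i => iter i (diag (s p n)) (f p n)) f
  (fun p n _ r => diag (s p n) r)) => //.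
apply: computable_diag; last by solve_computable.
by apply: (computable_comp hs); solve_computable.
Qed.

(** The witness codes a step bound and two iteration counts. Orbits that meet give the equivalence
    generated by a partial function. *)
Definition diag_test (x y w : nat) : bool :=
  iter (cfst (csnd w)) (diag (cfst w)) x ==
  iter (csnd (csnd w)) (diag (cfst w)) y.

Definition diag_rel (x y : nat) : Prop := exists w, diag_test x y w.

Lemma diag_relP x y : diag_rel x y <->
  exists s i j, iter i (diag s) x = iter j (diag s) y.
Proof.
split=> [[w /eqP e]|[s [i [j e]]]]; first by do 3 eexists; exact: e.
exists (cpair s (cpair i j)).
by apply/eqP; rewrite !(cfst_pair, csnd_pair).
Qed.

(** Applications that halted within [s] steps are kept; those that gave up were the identity and are
    dropped from the count. *)
Lemma iter_diag_leq s s' i x : s <= s' ->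
  exists j, iter i (diag s) x = iter j (diag s') x.
Proof.
move=> le; elim: i => [|i [j IH]]; first by exists 0.
rewrite /= IH; set z := iter j _ x; rewrite {1}/diag.
case: eqP => [h|_]; last by exists j.
by exists j.+1; rewrite /= -/z /diag (sim_halted le h) h.
Qed.

Lemma diag_rel_trans x y z : diag_rel x y -> diag_rel y z -> diag_rel x z.
Proof.
move=> /diag_relP[s [i [j e]]] /diag_relP[s' [i' [j' e']]]; apply/diag_relP.
have [i1 e1] := iter_diag_leq i x (leq_maxl s s').
have [j1 f1] := iter_diag_leq j y (leq_maxl s s').
have [i2 e2] := iter_diag_leq i' y (leq_maxr s s').
have [j2 f2] := iter_diag_leq j' z (leq_maxr s s').
rewrite e1 f1 in e; rewrite e2 f2 in e'.
(* Both orbits are continued to the iterate of [y] of order [i2 + j1]. *)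
exists (maxn s s'), (i2 + i1), (j1 + j2).
by rewrite !iterD e -e' -!iterD addnC.
Qed.

Lemma diag_rel_sym x y : diag_rel x y -> diag_rel y x.
Proof.
by move=> /diag_relP[s [i [j e]]]; apply/diag_relP; exists s, j, i.
Qed.

Lemma diag_rel_refl x : diag_rel x x.
Proof. by apply/diag_relP; exists 0, 0, 0. Qed.

Lemma computable_diag_test :
  computable_op (fun _ m => diag_test (cfst m) (cfst (csnd m)) (csnd (csnd m))).
Proof.
by apply: computable_eq; apply: computable_iter_diag; solve_computable.
Qed.

(** One application with enough steps takes the index to the output, so a machine can choose a
    number equivalent to its own index. *)
Lemma diag_rel_eval c v : eval (fun=> Defs.index c) c 0 v ->
  diag_rel (Defs.index c) v.
Proof.
move=> /eval_sim[s s0 s1]; apply/diag_relP; exists s, 1, 0.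
by rewrite /= /diag s0 eqxx.
Qed.

(** Both indices are fixed by every [diag s], so their orbits meet only if they coincide. *)
Lemma diag_rel_diverging c d :
  (forall o v, ~ eval o c 0 v) -> (forall o v, ~ eval o d 0 v) ->
  diag_rel (Defs.index c) (Defs.index d) -> c = d.
Proof.
have fix_diag e s i : (forall o v, ~ eval o e 0 v) ->
    iter i (diag s) (Defs.index e) = Defs.index e.
  move=> he; elim: i => //= i ->; rewrite /diag; case: eqP => // h.
  by exfalso; apply: he; apply/eval_sim; exists s; first exact: h.
move=> hc hd /diag_relP[s [i [j]]]; rewrite !fix_diag //; exact: Defs.index_inj.
Qed.

(** * Infinitely many classes, and constancy of computable maps *)

(** [Mu Succ] seeks a zero of the successor; the inner constant [k] makes the codes distinct. *)
Definition diverging (k : nat) : code := Comp (Mu Succ) (iter k (Comp Succ) Zero).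

Lemma diverging_eval k o n v : ~ eval o (diverging k) n v.
Proof. by move=> [m _ [/=]]. Qed.

Lemma diverging_inj : injective diverging.
Proof. by elim=> [|k IH] [|l] //= [e]; congr S; apply: IH; rewrite /diverging e. Qed.

Definition diagSpace : repSpace :=
  ceerSpace diag_rel_sym diag_rel_trans.

Lemma diagSpace_infinite : infinite_set [set: diagSpace].
Proof.
pose cl := class diag_rel_refl diag_rel_sym diag_rel_trans.
pose f k : diagSpace := cl (Defs.index (diverging k)).
have f_inj : injective f.
  move=> k l /class_eq/diag_rel_diverging e.
  by apply/diverging_inj/e => ? ?; apply: diverging_eval.
apply: (@sub_infinite_set _ (range f)) => //.
by rewrite (eq_finite_set (inj_card_eq (in2W f_inj))); apply: infinite_nat.
Qed.

Lemma diagSpace_constant (f : diagSpace -> natSpace) : computable_map f ->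
  exists n : nat, forall x, f x = n.
Proof.
move=> [F [c hc] hF].
pose cl n : diagSpace := class diag_rel_refl diag_rel_sym diag_rel_trans n.
have fE n : eval (fun=> n) c 0 (f (cl n)).
  by have [q /hc/(_ 0) + <-] := hF (fun=> n) (cl n) (diag_rel_refl n).
(* By symmetry, this inequality for all pairs yields constancy. *)
have le a b : f (cl b) <= f (cl a).
  rewrite leqNgt; apply/negP => lt.
  have [d hd] : computable_op (fun _ x => if x <= f (cl a) then b else a).
    by solve_computable.
  (* No recursion theorem is invoked: in [ee] the constant oracle hands [e] its own index, as a name
     of its own class. *)
  pose e := Comp d (Comp c Zero).
  have ee : eval (fun=> Defs.index e) e 0
      (if f (cl (Defs.index e)) <= f (cl a) then b else a).
    exists (f (cl (Defs.index e))); last exact: hd.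
    by exists 0 => //; apply: fE.
  have /class_eq-/(_ diag_rel_refl diag_rel_sym diag_rel_trans) := diag_rel_eval ee.
  (* The class of [e] is that of [b] if the test succeeds and that of [a] if it fails; each
     contradicts the test. *)
  rewrite -/(cl _); case: ifP => hle ecl.
    by move: hle; rewrite ecl leqNgt lt.
  by move: hle; rewrite ecl leqnn.
exists (f (cl 0)) => I; have [[x Ix] _ _] := proj2_sig I.
have -> : I = cl x.
  by apply: (@ideal_eq _ diag_rel_sym diag_rel_trans I (cl x) x) => //; apply: diag_rel_refl.
by apply/eqP; rewrite eqn_leq !le.
Qed.

Theorem mainTheorem3 :
  exists X : repSpace,
    [/\ infinite_set [set: X],
        computably_discrete X,
        computably_quasi_Polish X &
        forall f : X -> natSpace, computable_map f ->
          exists n : nat, forall x : X, f x = n].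
Proof.
have R_t x y : diag_rel x y <-> exists w, diag_test x y w by [].
exists diagSpace; split; [exact: diagSpace_infinite|..|exact: diagSpace_constant].
- exact: ceerSpace_discrete R_t computable_diag_test.
- split; first exact: ceerSpace_precomputably_quasi_Polish R_t computable_diag_test.
  by apply: ceerSpace_overt; apply: diag_rel_refl.
Qed.
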